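(* Let $(\mathbb X,\|\cdot\|)$, $(\mathbb W,\|\cdot\|)$, $(\mathbb Y,\|\cdot\|)$ be real Banach spaces, let $h:\mathbb X\to\mathbb W$ and $g:\mathbb X\to\mathbb Y$ be mappings, let $K\subseteq\mathbb W$ be a closed, convex and pointed cone with apex at the null vector of $\mathbb W$, let $C\subseteq\mathbb Y$ be a nonempty, closed and convex set, let $R=g^{-1}(C)$, let $\Omega\subseteq\mathbb X$ be open, and let $x_0\in\Omega\cap R$. Suppose that: (i) $(\mathbb X,\|\cdot\|)$ is uniformly convex with modulus of convexity $\delta_{\mathbb X}$ satisfying the quadratic growth condition; (ii) $(\mathbb W,\|\cdot\|)$ and $(\mathbb Y,\|\cdot\|)$ are reflexive Banach spaces; (iii) $h$ and $g$ are of class $\mathrm C^{1,1}(\Omega)$ and the derivative $\mathrm D(h,g)(x_0)\in\mathcal L(\mathbb X,\mathbb W\times\mathbb Y)$ is onto. Then there exists $\epsilon_0>0$ such that for every $\epsilon\in(0,\epsilon_0]$ there are $x_\epsilon\in\mathrm{bd}\,\mathrm B(x_0;\epsilon)$ and $(w^*_\epsilon,y^*_\epsilon)\in(\mathbb W^*\times\mathbb Y^* )\setminus\{(\mathbf 0^*,\mathbf 0^* )\}$ such that $$x_\epsilon\ \text{ is a global solution to } (\mathcal{VOP}_{x_0,\epsilon}),$$ $$w^*_\epsilon\in K^\oplus\setminus\{\mathbf 0^*\},\qquad -y^*_\epsilon\in \mathrm N(g(x_\epsilon);C),$$ $$\mathrm L(w^*_\epsilon,y^*_\epsilon;x_\epsilon)\ge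 \mathrm L(w^*_\epsilon,y^*_\epsilon;x)\quad\text{for all } x\in\mathrm B(x_0;\epsilon).$$
   Context: $\mathrm B(x;r)$ is the closed ball with centre $x$ and radius $r$; $\mathrm{bd}$ denotes the boundary; $\mathbb B$ is the closed unit ball; $\mathbf 0$ and $\mathbf 0^*$ denote null vectors. Modulus of convexity: $\delta_{\mathbb X}(\epsilon)=\inf\{1-\|\frac{x_1+x_2}{2}\|: x_1,x_2\in\mathbb B,\ \|x_1-x_2\|\ge\epsilon\}$ for $\epsilon\in[0,2]$. $\mathbb X$ is uniformly convex if $\delta_{\mathbb X}(\epsilon)>0$ for all $\epsilon\in(0,2]$. The modulus satisfies the quadratic growth condition if there is $\kappa>0$ with $\delta_{\mathbb X}(\epsilon)\ge\kappa\epsilon^2$ for all $\epsilon\in[0,2]$. A mapping $f$ is of class $\mathrm C^{1,1}(\Omega)$ if it is Fréchet differentiable at each point of the open set $\Omega$ and the derivative map $\mathrm Df$ is Lipschitz continuous on $\Omega$ with respect to the operator norm. $\mathcal L(\mathbb X,\mathbb W\times\mathbb Y)$ is the space of bounded linear maps; $(h,g):\mathbb X\to\mathbb W\times\mathbb Y$, $x\mapsto(h(x),g(x))$. A cone $K$ is pointed if $K\cap(-K)=\{\mathbf 0\}$. $K^\oplus=\{w^*\in\mathbb W^*:\langle w^*,w\rangle\ge0\ \forall w\in K\}$. For $C$ convex and $y_0\in C$, $\mathrm N(y_0;C)=\{y^*\in\mathbb Y^*:\langle y^*,y-y_0\rangle\le 0\ \forall y\in C\}$ is the normal cone of convex analysis.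 Problem $(\mathcal{VOP}_{x_0,\epsilon})$: maximize $h(x)$ with respect to the partial order $w_1\le_K w_2\iff w_2-w_1\in K$, over $x\in\mathrm B(x_0;\epsilon)$ subject to $g(x)\in C$. A point $\bar x\in R\cap\mathrm B(x_0;\epsilon)$ is a global solution of it if $h(R\cap \mathrm B(x_0;\epsilon))\cap(h(\bar x)+K)=\{h(\bar x)\}$. Lagrangian: $\mathrm L(w^*,y^*;x)=\langle w^*,h(x)\rangle+\langle y^*,g(x)\rangle$ for $(w^*,y^*,x)\in\mathbb W^*\times\mathbb Y^*\times\mathbb X$.
   Formalization: The formal theorem additionally assumes that W is not the zero space; if W = {0}, then K^⊕ \ {0*} is empty and the claim fails (e.g. X = Y = ℝ, h = 0, g = id, C = ℝ). *)

(* Defs.v *)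
From HB Require Import structures.
From mathcomp Require Import all_boot all_order all_algebra.
From mathcomp Require Import all_classical all_reals all_analysis.
Set Implicit Arguments.
Unset Strict Implicit.
Unset Printing Implicit Defensive.
Import Order.TTheory GRing.Theory Num.Theory.
Import numFieldNormedType.Exports.
Local Open Scope classical_set_scope.
Local Open Scope ring_scope.

Section BoundedLinearMaps.
Variables (R : realType) (V W : normedModType R).

(* Boundedness is stated as continuity; the two agree for linear maps by
   linear_bounded_continuous. *)
Definition bounded_linear : {pred V -> W} :=
  [pred f | `[< linear f /\ continuous f >]].

Record blin := Blin { blin_fun :> V -> W; _ : blin_fun \in bounded_linear }.

HB.instance Definition _ := [isSub for blin_fun].
HB.instance Definition _ := [Choice of blin by <:].

Lemma bounded_linearP (f : V -> W) :
  reflect (linear f /\ continuous f) (f \in bounded_linear).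
Proof. exact: asboolP. Qed.

Lemma blin_linear (f : blin) : linear f.
Proof. by case: f => f /= /bounded_linearP[]. Qed.

Lemma blin_continuous (f : blin) : continuous f.
Proof. by case: f => f /= /bounded_linearP[]. Qed.

HB.instance Definition _ (f : blin) :=
  GRing.isLinear.Build R V W _ (f : V -> W) (@blin_linear f).

Lemma bounded_linear_submod : submod_closed bounded_linear.
Proof.
split.
  apply/bounded_linearP; split; last exact: cst_continuous.
  by move=> a x y; rewrite -[0]/(cst 0) /= scaler0 addr0.
move=> a f g /bounded_linearP[lf cf] /bounded_linearP[lg cg].
apply/bounded_linearP; split.
  move=> b x y; rewrite -[LHS]/(a *: f (b *: x + y) + g (b *: x + y)).
  rewrite -[in RHS]/(b *: (a *: f x + g x) + (a *: f y + g y)).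
  by rewrite lf lg !scalerDr !scalerA addrACA [a * b]mulrC.
move=> x; apply: (@continuousD _ _ _ (a *: f) g); last exact: cg.
by apply: continuousZl_tmp; exact: cf.
Qed.

HB.instance Definition _ :=
  GRing.isSubmodClosed.Build _ _ bounded_linear bounded_linear_submod.
HB.instance Definition _ := [SubChoice_isSubLmodule of blin by <:].

Definition opnorm (f : blin) : R :=
  sup [set `|f x| | x in [set x | `|x| <= 1]].

Lemma opnorm_has_sup (f : blin) :
  has_sup [set `|f x| | x in [set x | `|x| <= 1]].
Proof.
split; first by exists `|f 0|, 0 => //=; rewrite normr0 ler01.
have [k k0 fk] := linear_lipschitz (@blin_continuous f).
exists k => _ [x /= x1 <-].
by apply: le_trans (fk x) _; rewrite ler_piMr// ltW.
Qed.

Lemma opnorm_ub (f : blin) x : `|f x| <= opnorm f * `|x|.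
Proof.
have [->|x0] := eqVneq x 0; first by rewrite linear0 !normr0 mulr0.
rewrite -ler_pdivrMr ?normr_gt0//.
have -> : `|f x| / `|x| = `|f (`|x|^-1 *: x)|.
  by rewrite linearZ normrZ normfV normr_id mulrC.
apply: (ub_le_sup (opnorm_has_sup f).2).
by exists (`|x|^-1 *: x) => //=; rewrite normrZ normfV normr_id mulVf ?normr_eq0.
Qed.

Lemma opnorm_le (f : blin) k :
  (forall x, `|x| <= 1 -> `|f x| <= k) -> opnorm f <= k.
Proof.
move=> fk; apply: ge_sup; first exact: (opnorm_has_sup f).1.
by move=> _ [x /= x1 <-]; exact: fk.
Qed.

Lemma opnorm_ge0 (f : blin) : 0 <= opnorm f.
Proof.
apply: le_trans (normr_ge0 (f 0)) _; apply: (ub_le_sup (opnorm_has_sup f).2).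
by exists 0 => //=; rewrite normr0 ler01.
Qed.

Lemma opnorm_triangle (f g : blin) : opnorm (f + g) <= opnorm f + opnorm g.
Proof.
apply: opnorm_le => x x1; apply: le_trans (ler_normD (f x) (g x)) _.
by rewrite lerD// (le_trans (opnorm_ub _ _))// ler_piMr// opnorm_ge0.
Qed.

Lemma opnormZ_le (a : R) (f : blin) : opnorm (a *: f) <= `|a| * opnorm f.
Proof.
apply: opnorm_le => x x1.
rewrite -[(a *: f) x]/(a *: f x) normrZ ler_wpM2l//.
by rewrite (le_trans (opnorm_ub _ _))// ler_piMr// opnorm_ge0.
Qed.

Lemma opnormZ (a : R) (f : blin) : opnorm (a *: f) = `|a| * opnorm f.
Proof.
apply/le_anti/andP; split; first exact: opnormZ_le.
have [->|a0] := eqVneq a 0; first by rewrite normr0 mul0r opnorm_ge0.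
rewrite -ler_pdivlMl ?normr_gt0// -normfV.
by rewrite -[in leLHS](scalerK a0 f) opnormZ_le.
Qed.

Lemma opnorm_eq0 (f : blin) : opnorm f = 0 -> f = 0.
Proof.
move=> f0; apply/val_inj/funext => x; apply/eqP; rewrite -normr_le0.
by have := opnorm_ub f x; rewrite f0 mul0r.
Qed.

HB.instance Definition _ :=
  Lmodule_isNormed.Build R blin opnorm_triangle opnormZ opnorm_eq0.

Lemma blin_normE (f : blin) : `|f| = opnorm f.
Proof. by []. Qed.

End BoundedLinearMaps.

Notation dual V := (blin V _^o).

Section BanachSpaces.
Variables (R : realType) (V W : normedModType R).

(* Surjectivity of the canonical embedding of V into its bidual. *)
Definition reflexive_space :=
  forall phi : dual (dual V), exists v : V, forall f : dual V, phi f = f v.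

(* Valued in \bar R so that the infimum over the empty set, which occurs only
   when V is trivial, is +oo. *)
Definition convexity_modulus (e : R) : \bar R :=
  ereal_inf [set (1 - `|2^-1 *: (x.1 + x.2)|)%:E | x in
    [set x : V * V | [/\ `|x.1| <= 1, `|x.2| <= 1 & e <= `|x.1 - x.2|]]].

Definition uniformly_convex :=
  forall e : R, 0 < e <= 2 -> (0 < convexity_modulus e)%E.

Definition quadratic_growth :=
  exists2 kappa : R, 0 < kappa &
    forall e : R, 0 <= e <= 2 -> ((kappa * e ^+ 2)%:E <= convexity_modulus e)%E.

Definition class_C11 (f : V -> W) (Omega : set V) :=
  exists2 Df : V -> blin V W,
    (forall x, Omega x -> is_diff x f (Df x)) & [lipschitz Df x | x in Omega].

Definition boundary (A : set V) : set V := closure A `\` A°.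

Definition cone (K : set V) :=
  K !=set0 /\ forall (t : R) v, 0 <= t -> K v -> K (t *: v).

Definition pointed_cone (K : set V) := K `&` -%R @` K = [set 0].

Definition dual_cone (K : set V) : set (dual V) :=
  [set f : dual V | forall v, K v -> 0 <= f v].

Definition normal_cone (y0 : V) (C : set V) : set (dual V) :=
  [set f : dual V | forall y, C y -> f (y - y0) <= 0].

End BanachSpaces.

Section VectorOptimization.
Variables (R : realType) (X W Y : normedModType R) (h : X -> W) (g : X -> Y).

Definition VOP_solution (K : set W) (C : set Y) (x0 : X) (e : R) (xbar : X) :=
  let F := g @^-1` C `&` closed_ball x0 e in
  F xbar /\ h @` F `&` [set h xbar + k | k in K] = [set h xbar].

Definition lagrangian (ws : dual W) (ys : dual Y) (x : X) : R :=
  ws (h x) + ys (g x).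

End VectorOptimization.

(* Main.v *)
Require Import Defs.
From HB Require Import structures.
From mathcomp Require Import all_boot all_order all_algebra.
From mathcomp Require Import all_classical all_reals all_analysis.
From mathcomp Require Import ring lra.
Set Implicit Arguments.
Unset Strict Implicit.
Unset Printing Implicit Defensive.
Import Order.TTheory GRing.Theory Num.Theory.
Import numFieldNormedType.Exports.
Local Open Scope classical_set_scope.
Local Open Scope ring_scope.

(** Why the theorem holds.

    Put [f x := (h x, g x)]. The heart of the matter is a quantitative form of
    Polyak's convexity principle ([convexity_principle]): for small [eps] the
    image under [f] of the closed ball [B] with centre [x0] and radius [eps] is
    strongly convex, in the sense that the point [(1 - t) f(x1) + t f(x2)] is
    surrounded by a ball of radius [c t (1 - t) |x1 - x2|^2] contained in
    [f(B)]. Three estimates compete. By quadratic growth of the modulus of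
    convexity, the point [xt := (1 - t) x1 + t x2] lies at depth at least
    [(2 kappa / eps) t (1 - t) |x1 - x2|^2] inside [B] ([convex_comb_depth]). By
    surjectivity of the derivative, [f] maps a ball around [xt] onto a
    neighbourhood of [f(xt)] of proportional radius ([graves]), where the
    constant does not depend on [xt] or on the radius. By Lipschitz continuity
    of the derivative, [f(xt)] differs from [(1 - t) f(x1) + t f(x2)] by at most
    [L t (1 - t) |x1 - x2|^2] ([chord_deviation]). The factor [1 / eps] in the
    first estimate makes it win when [eps] is small.

    Strong convexity then yields both existence and uniqueness of optima. Take
    a nonzero [ws] in the dual cone of [K] ([dual_cone_nonzero]) and maximize
    [ws (h x)] over the feasible points of [B]. Between two feasible points
    [x1], [x2] there is a feasible point whose value exceeds the mean of theirs
    by a multiple of [|x1 - x2|^2] ([midpoint_gain]), so maximizing sequences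
    are Cauchy and the maximizer [xe] is unique ([strongly_concave_max]).
    A feasible point whose value under [h] lies in [h xe + K] also maximizes
    [ws], hence equals [xe]: uniqueness turns a maximizer of the scalar problem
    into a solution of the vector problem.

    Multipliers come from separating the convex set
    [{(h x - k, g x - y) : x in B, k in K, y in C}] from the point [(h xe, 0)],
    which is not interior to it because [xe] is a maximizer
    ([multiplier_of_maximum]). The functional obtained is strictly smaller at
    the interior point [(h x0, 0)] than at [(h xe, 0)]. As these two points
    differ in the first component only, the first component of the functional
    is nonzero. Finally [xe] cannot be interior to [B], since [f] is open there
    and a nonzero functional has no local maximum on an open set. *)

(** * The Hahn-Banach theorem *)

Section HahnBanach.
Context {R : realType} {V : lmodType R}.
Implicit Types (p q : V -> R) (x y v : V).

Definition sublinear p :=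
  (forall x y, p (x + y) <= p x + p y) /\
  (forall (t : R) x, 0 <= t -> p (t *: x) = t * p x).

Lemma sublinear0 p : sublinear p -> p 0 = 0.
Proof. by case=> _ pZ; rewrite -(scale0r (0 : V)) pZ// mul0r. Qed.

Lemma sublinear_geN p x : sublinear p -> - p (- x) <= p x.
Proof.
move=> sp; have := sp.1 x (- x).
by rewrite subrr (sublinear0 sp); lra.
Qed.

(** Positive homogeneity only has to be checked as an inequality, because
    scaling by [t] can be undone by scaling by [t^-1]. *)
Lemma sublinear_from_le p :
  p 0 = 0 -> (forall x y, p (x + y) <= p x + p y) ->
  (forall (t : R) x, 0 < t -> p (t *: x) <= t * p x) -> sublinear p.
Proof.
move=> p0 pD pZ; split=> // t x; rewrite le_eqVlt => /predU1P[<-|t0].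
  by rewrite scale0r p0 mul0r.
apply/le_anti; rewrite pZ//=.
have := pZ t^-1 (t *: x); rewrite invr_gt0 => /(_ t0).
by rewrite scalerA mulVf ?gt_eqF// scale1r -ler_pdivlMl.
Qed.

(** The largest sublinear functional below [q] whose value at [- v] is at most
    [- q v]. For a minimal sublinear [q] it is [q] itself, which forces
    linearity; and a linear functional below [tilt q v] agrees with [q] at [v]. *)
Definition tilt q v x : R :=
  inf [set q (x + t *: v) - t * q v | t in [set t : R | 0 <= t]].

Section Tilt.
Variables (q : V -> R) (v : V).
Hypothesis sq : sublinear q.

Lemma tilt_le t x : 0 <= t -> tilt q v x <= q (x + t *: v) - t * q v.
Proof.
move=> t0; apply: ge_inf; last by exists t.
exists (- q (- x)) => _ [s /= s0 <-].
have := sq.1 (- x) (x + s *: v).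
by rewrite addrA addNr add0r sq.2//; lra.
Qed.

Lemma tilt_glb x b :
  (forall t : R, 0 <= t -> b <= q (x + t *: v) - t * q v) -> b <= tilt q v x.
Proof.
move=> bq; apply: lb_le_inf => [|_ [t /= t0 <-]]; last exact: bq.
by exists (q (x + 0 *: v) - 0 * q v), 0 => /=.
Qed.

Lemma tilt_le_self x : tilt q v x <= q x.
Proof. by have := tilt_le x (lexx 0); rewrite scale0r addr0 mul0r subr0. Qed.

Lemma tilt_opp : tilt q v (- v) <= - q v.
Proof.
have := tilt_le (- v) ler01.
by rewrite scale1r addNr (sublinear0 sq) mul1r sub0r.
Qed.

Lemma sublinear_tilt : sublinear (tilt q v).
Proof.
apply: sublinear_from_le.
- apply/le_anti; rewrite -{1}(sublinear0 sq) tilt_le_self/=.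
  by apply: tilt_glb => t t0; rewrite add0r sq.2// subrr.
- move=> x y; rewrite -lerBlDr; apply: tilt_glb => s s0.
  rewrite lerBlDr [leRHS]addrC -lerBlDr; apply: tilt_glb => t t0.
  rewrite lerBlDr.
  have := tilt_le (x + y) (addr_ge0 s0 t0).
  have := sq.1 (x + s *: v) (y + t *: v); rewrite addrACA -scalerDl; lra.
- move=> t x t0; rewrite -ler_pdivrMl//; apply: tilt_glb => s s0.
  rewrite ler_pdivrMl//; apply: le_trans (tilt_le (t:=t * s) _ _) _.
    by rewrite mulr_ge0// ltW.
  by rewrite -scalerA -scalerDr (sq.2 _ _ (ltW t0)) mulrBr mulrA.
Qed.

End Tilt.

(** Minimality makes [tilt q y] equal to [q], and then the bound of [tilt_le] at
    [t = 1] is superadditivity of [q]. *)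
Lemma minimal_sublinear_linear q :
  sublinear q -> (forall q', sublinear q' -> (forall x, q' x <= q x) -> q' = q) ->
  linear (q : V -> R^o).
Proof.
move=> sq qmin.
have qD x y : q (x + y) = q x + q y.
  apply/le_anti; rewrite sq.1/=.
  have := tilt_le y sq x ler01.
  rewrite (qmin _ (sublinear_tilt y sq) (tilt_le_self y sq)).
  by rewrite scale1r mul1r lerBrDr.
have qN x : q (- x) = - q x.
  by apply/eqP; rewrite -addr_eq0 -qD addNr (sublinear0 sq).
move=> t x y; rewrite qD; congr (_ + _).
have [t0|/ltW t0] := leP 0 t; first exact: sq.2.
by rewrite -[t]opprK scaleNr qN sq.2 ?oppr_ge0// scaleNr.
Qed.

(** Zorn's lemma for the reversed pointwise order on the sublinear functionals
    below [p]. The infimum of a chain is finite because of the lower bound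
    [- p (- x)], and subadditive because any two members of the chain are both
    above the smaller one. *)
Lemma sublinear_minorant p :
  sublinear p -> exists f : V -> R^o, linear f /\ forall x, f x <= p x.
Proof.
move=> sp.
pose T := {q : V -> R | sublinear q /\ forall x, q x <= p x}.
pose ge (q1 q2 : T) := `[< forall x, sval q2 x <= sval q1 x >].
have := @Zorn T ge.
case=> [q|q1 q2 q3|q1 q2|Q Qtot|q qmin]; rewrite /ge.
- by apply/asboolP.
- by move=> /asboolP q12 /asboolP q23; apply/asboolP => x; apply: le_trans (q12 x).
- case: q1 q2 => [q1 q1P] [q2 q2P] /asboolP/= q12 /asboolP/= q21.
  apply: eq_exist.
  by apply/funext => x; apply/le_anti; rewrite q12 q21.
- have [[q0 Qq0]|Q0] := pselect (Q !=set0); last first.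
    by exists (exist _ p (conj sp (fun x => lexx _))) => s Qs; case: Q0; exists s.
  pose r x := inf [set sval q x | q in Q].
  have r_le (q : T) x : Q q -> r x <= sval q x.
    move=> Qq; apply: ge_inf; last by exists q.
    exists (- p (- x)) => _ [s Qs <-].
    case: s {Qs} => s [ss sp'] /=; apply: le_trans (sublinear_geN x ss).
    by rewrite lerN2.
  have r_glb x b : (forall q : T, Q q -> b <= sval q x) -> b <= r x.
    move=> bq; apply: lb_le_inf => [|_ [q Qq <-]]; last exact: bq.
    by exists (sval q0 x), q0.
  have sr : sublinear r.
    apply: sublinear_from_le.
    + apply/le_anti; rewrite -{1}(sublinear0 (proj1 (svalP q0))) r_le//=.
      by apply/r_glb => q Qq; rewrite (sublinear0 (proj1 (svalP q))).
    + move=> x y; rewrite -lerBlDr. apply/r_glb => q1 Qq1.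
      rewrite lerBlDr [leRHS]addrC -lerBlDr; apply/r_glb => q2 Qq2; rewrite lerBlDr.
      have [/asboolP q12|/asboolP q21] := Qtot _ _ Qq1 Qq2.
        apply: le_trans (r_le _ _ Qq2) _.
        apply: le_trans ((proj1 (svalP q2)).1 x y) _.
        by rewrite addrC lerD2l q12.
      apply: le_trans (r_le _ _ Qq1) _.
      apply: le_trans ((proj1 (svalP q1)).1 x y) _.
      by rewrite addrC lerD2r q21.
    + move=> t x t0; rewrite -ler_pdivrMl//; apply/r_glb => q Qq.
      rewrite ler_pdivrMl//; apply: le_trans (r_le _ _ Qq) _.
      by rewrite ((proj1 (svalP q)).2 _ _ (ltW t0)).
  have rp x : r x <= p x by apply: le_trans (r_le _ x Qq0) (proj2 (svalP q0) x).
  exists (exist _ r (conj sr rp)) => s Qs; apply/asboolP => x /=.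
  exact: r_le.
- have [sq qp] := svalP q; exists (sval q); split=> //.
  apply: minimal_sublinear_linear => // q' sq' q'q.
  have q'p x : q' x <= p x by apply: le_trans (q'q x) (qp x).
  have := qmin (exist _ q' (conj sq' q'p)).
  by rewrite /ge => /(_ (asboolT q'q)) <-.
Qed.

(** Hahn-Banach in the form used below: domination by [p] with equality at a
    prescribed point. *)
Lemma sublinear_support p v : sublinear p ->
  exists f : V -> R^o, [/\ linear f, forall x, f x <= p x & f v = p v].
Proof.
move=> sp; have [f [lf fp]] := sublinear_minorant (sublinear_tilt v sp).
have fle x : f x <= p x by apply: le_trans (fp x) (tilt_le_self v sp x).
exists f; split=> //; apply/le_anti; rewrite fle/=.
have := le_trans (fp (- v)) (tilt_opp v sp).
have -> : f (- v) = - f v.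
  pose f' : {linear V -> R^o} := HB.pack f (GRing.isLinear.Build R V R^o _ f lf).
  by rewrite -[f]/(f' : V -> R^o) linearN.
by rewrite lerN2.
Qed.

End HahnBanach.

(** * Separation of convex sets *)

Lemma convex_setP {R : realType} {V : lmodType R} (A : set V) :
  convex_set A <-> forall (x y : V) (t : R), A x -> A y -> 0 <= t <= 1 ->
    A ((1 - t) *: x + t *: y).
Proof.
split=> [cA x y t Ax Ay /andP[t0 t1]|cA x y t /set_mem Ax /set_mem Ay].
  by have /set_mem := cA y x (Itv01 t0 t1) (mem_set Ay) (mem_set Ax); rewrite addrC.
apply: mem_set; rewrite [conv _ _ _]addrC; apply: cA => //.
by rewrite ge0 le1.
Qed.

Section Separation.
Context {R : realType} {V : normedModType R}.
Implicit Types (A : set V) (v x y z : V).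

Lemma dualN (phi : dual V) x : (phi (- x) : R) = - (phi x : R).
Proof. exact: (linearN phi). Qed.

Lemma dualD (phi : dual V) x y : (phi (x + y) : R) = (phi x : R) + (phi y : R).
Proof. exact: (linearD phi). Qed.

Lemma dualB (phi : dual V) x y : (phi (x - y) : R) = (phi x : R) - (phi y : R).
Proof. exact: (linearB phi). Qed.

Lemma dualZ (phi : dual V) (t : R) x : (phi (t *: x) : R) = t * (phi x : R).
Proof. exact: (linearZ_LR phi). Qed.

Lemma dual_of_le_norm (f : V -> R^o) :
  linear f -> (forall x, f x <= `|x|) -> exists phi : dual V, phi =1 f.
Proof.
move=> lf fle.
pose f' : {linear V -> R^o} := HB.pack f (GRing.isLinear.Build R V R^o _ f lf).
have cf : continuous f'.
  apply: bounded_linear_continuous; exists 1; split=> // b b1.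
  apply/nbhs_ballP; exists 1 => //= x; rewrite -ball_normE/= sub0r normrN => x1.
  rewrite ler_norml; apply/andP; split; last first.
    by apply: le_trans (fle x) _; apply/ltW/(lt_trans x1).
  rewrite lerNl -(linearN f'); apply: le_trans (fle _) _.
  by rewrite normrN; apply/ltW/(lt_trans x1).
have fb : f \in @bounded_linear R V R^o by apply/bounded_linearP.
by exists (Blin fb).
Qed.

(** Besides its use in the mean value inequality, this separates points, which
    gives [dual_ext]. *)
Lemma norming_functional v :
  exists phi : dual V, phi v = `|v| /\ forall x, `|phi x| <= `|x|.
Proof.
have [|f [lf /= fle fv]] := @sublinear_support R V (fun x => `|x|) v.
  by split=> [x y|t x t0]; [exact: ler_normD|rewrite normrZ ger0_norm].
have [phi phif] := dual_of_le_norm lf fle.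
exists phi; rewrite phif; split=> // x.
rewrite ler_norml lerNl -dualN !phif.
by apply/andP; split; [have := fle (- x); rewrite normrN|exact: fle x].
Qed.

(** Identities between vectors reduce to identities between real numbers, where
    [ring] and [field] apply. *)
Lemma dual_ext x y : (forall phi : dual V, (phi x : R) = phi y) -> x = y.
Proof.
move=> xy; have [phi [phi_norm _]] := norming_functional (x - y).
by apply/eqP; rewrite -subr_eq0 -normr_eq0 -phi_norm dualB xy subrr.
Qed.

Definition dualE := (dualB, dualD, dualN, dualZ).

(** The distance from [x] to the cone spanned by [A - v]. It vanishes on [A - v]
    and is dominated by the norm, so a linear functional below it is continuous
    and at most its value at [v] all over [A]. *)
Definition dist_cone A v x : R :=
  inf [set `|x - u.1 *: (u.2 - v)| | u in [set u : R * V | 0 <= u.1 /\ A u.2]].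

Section DistCone.
Variables (A : set V) (v a0 : V).
Hypotheses (cA : convex_set A) (Aa0 : A a0).

Lemma dist_cone_le x t a : 0 <= t -> A a -> dist_cone A v x <= `|x - t *: (a - v)|.
Proof.
move=> t0 Aa; apply: ge_inf; last by exists (t, a).
by exists 0 => _ [u _ <-].
Qed.

Lemma dist_cone_glb x b :
  (forall t a, 0 <= t -> A a -> b <= `|x - t *: (a - v)|) -> b <= dist_cone A v x.
Proof.
move=> bA; apply: lb_le_inf => [|_ [u [u0 Au] <-]]; last exact: bA.
by exists `|x - 0 *: (a0 - v)|, (0, a0).
Qed.

Lemma dist_cone_ge0 x : 0 <= dist_cone A v x.
Proof. exact: dist_cone_glb. Qed.

Lemma dist_cone_le_norm x : dist_cone A v x <= `|x|.
Proof. by have := dist_cone_le x (lexx 0) Aa0; rewrite scale0r subr0. Qed.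

Lemma sublinear_dist_cone : sublinear (dist_cone A v).
Proof.
apply: sublinear_from_le.
- apply/le_anti; rewrite dist_cone_ge0 andbT.
  by have := dist_cone_le_norm 0; rewrite normr0.
- move=> x y; rewrite -lerBlDr; apply: dist_cone_glb => s a s0 Aa.
  rewrite lerBlDr [leRHS]addrC -lerBlDr; apply: dist_cone_glb => t b t0 Ab.
  rewrite lerBlDr; apply: le_trans (ler_normD _ _).
  have [st0|st0] := eqVneq (s + t) 0.
    have s00 : s = 0 by lra.
    have t00 : t = 0 by lra.
    by rewrite s00 t00 !scale0r !subr0 [y + x]addrC dist_cone_le_norm.
  have stp : 0 < s + t by rewrite lt_neqAle eq_sym st0 addr_ge0.
  have Ac : A ((1 - t / (s + t)) *: a + (t / (s + t)) *: b).
    apply: (convex_setP A).1 => //; rewrite divr_ge0 ?(ltW stp)//=.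
    by rewrite ler_pdivrMr// mul1r lerDr.
  apply: le_trans (dist_cone_le (x + y) (ltW stp) Ac) _.
  rewrite le_eqVlt; apply/orP; left; apply/eqP; congr (`|_|).
  by apply: dual_ext => phi; rewrite !dualE; field.
- move=> t x t0; rewrite -ler_pdivrMl//; apply: dist_cone_glb => s a s0 Aa.
  rewrite ler_pdivrMl//; apply: le_trans (dist_cone_le (t:=t * s) _ _ Aa) _.
    by rewrite mulr_ge0// ltW.
  by rewrite -scalerA -scalerBr normrZ gtr0_norm.
Qed.

End DistCone.

(** If the distance from [v - a0] to the cone spanned by [A - v] were less than
    [r], then [v - a0 = t (a - v) + e] with [|e| < r], which exhibits [v] as the
    convex combination with weights [1 / (1 + t)] and [t / (1 + t)] of the
    interior point [a0 + e] and of [a], hence as an interior point of [A]. *)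
Theorem convex_separation A a0 r v : convex_set A -> 0 < r ->
  (forall x, `|x - a0| < r -> A x) -> ~ A° v ->
  exists phi : dual V, phi a0 < phi v /\ forall x, A x -> phi x <= phi v.
Proof.
move=> cA r0 Ar vA.
have Aa0 : A a0 by apply: Ar; rewrite subrr normr0.
have [f [lf fle fv]] := sublinear_support (v - a0) (sublinear_dist_cone v cA Aa0).
have [|phi phif] := dual_of_le_norm lf.
  by move=> x; apply: le_trans (fle x) (dist_cone_le_norm _ Aa0 _).
exists phi; split; last first.
  move=> x Ax; rewrite -subr_le0 -dualB phif; apply: le_trans (fle _) _.
  by have := dist_cone_le v (x - v) ler01 Ax; rewrite scale1r subrr normr0.
rewrite -subr_gt0 -dualB phif fv; apply: lt_le_trans r0 _.
apply: (dist_cone_glb Aa0) => t a t0 Aa; rewrite leNgt; apply/negP => er.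
set e := _ - _ in er.
apply: vA; apply/nbhs_ballP; exists ((r - `|e|) / (1 + t)) => /=.
  by rewrite divr_gt0 ?subr_gt0// ltr_wpDr.
move=> z; rewrite -ball_normE/= => vz.
have t1 : 1 + t != 0 by lra.
(* A point [z] near [v] is the same convex combination, with the displacement
   [z - v] absorbed by the interior end point. *)
set y := a0 + e + (1 + t) *: (z - v).
have -> : z = (1 - t / (1 + t)) *: y + (t / (1 + t)) *: a.
  by apply: dual_ext => psi; rewrite /y /e !dualE; field.
apply: (convex_setP A).1 => //; last first.
  by rewrite divr_ge0 ?ler_pdivrMr ?mul1r//; lra.
apply: Ar; rewrite /y -[a0 + e + _]addrA [_ - a0]addrC addKr.
apply: le_lt_trans (ler_normD _ _) _; rewrite normrZ gtr0_norm; last by lra.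
by move: vz; rewrite distrC ltr_pdivlMr; lra.
Qed.

End Separation.

(** * The mean value inequality *)

Section MeanValue.
Context {R : realType} {V W : normedModType R}.

(** The scalar mean value theorem for [t |-> phi (f (a + t (b - a)) - t T (b - a))],
    where [phi] is norming for the vector to be estimated. *)
Lemma mean_value_deviation (f : V -> W) (Df : V -> blin V W) (T : blin V W)
    (a b : V) (k : R) :
  (forall t : R, 0 <= t <= 1 ->
    is_diff (a + t *: (b - a)) f (Df (a + t *: (b - a)))) ->
  (forall t : R, 0 <= t <= 1 -> `|Df (a + t *: (b - a)) - T| <= k) ->
  `|f b - f a - T (b - a)| <= k * `|b - a|.
Proof.
move=> fdiff fk; set d := b - a.
have [phi [phiv phi1]] := norming_functional (f b - f a - T d).
pose path (t : R) : V := a + t *: d.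
have path_diff (t : R) : is_diff t path ( *:%R^~ d).
  have := is_diffD (is_diff_cst a t) (is_diff_scalel t d).
  by rewrite add0r.
pose F (t : R) : R := phi (f (path t)) - t * phi (T d).
have F_derive (t : R) : 0 <= t <= 1 ->
    is_derive t (1 : R) F ((phi (Df (path t) d) : R) - phi (T d)).
  move=> t01.
  have phi_diff x : is_diff x (phi : W -> R) phi.
    apply: DiffDef; first exact/linear_differentiable/blin_continuous.
    by rewrite diff_lin//; exact: blin_continuous.
  have := is_diff_comp (is_diff_comp (path_diff t) (fdiff t t01)) (phi_diff _).
  move=> dphi.
  have := is_diffB dphi (is_diff_scalel t (phi (T d) : R)).
  case=> dF DF; apply: DeriveDef; first exact: diff_derivable.
  rewrite deriveE// DF.
  rewrite -[LHS]/((phi (Df (path t) (1 *: d)) : R) - 1 * phi (T d)).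
  by rewrite scale1r mul1r.
have Fcont : {within `[0, 1], continuous F}.
  apply: continuous_in_subspaceT => t; rewrite inE/= in_itv/= => t01.
  by apply/differentiable_continuous/derivable1_diffP; case: (F_derive t t01).
have F'01 (t : R) : t \in `]0, 1[ ->
    is_derive t (1 : R) F ((phi (Df (path t) d) : R) - phi (T d)).
  by rewrite in_itv/= => /andP[t0 t1]; apply: F_derive; rewrite !ltW.
have [c] := MVT ltr01 F'01 Fcont.
rewrite in_itv/= subr0 mulr1 => /andP[c0 c1].
rewrite /F /path scale1r scale0r addr0 /d [a + _]addrC subrK -/d mul1r mul0r subr0.
rewrite -phiv !dualB [X in X = _ -> _]addrAC => ->.
rewrite -dualB -[Df _ d - T d]/((Df (path c) - T) d).
have c01 : 0 <= c <= 1 by rewrite !ltW.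
apply: le_trans (ler_norm _) _; apply: le_trans (phi1 _) _.
apply: le_trans (opnorm_ub _ _) _.
by rewrite ler_wpM2r// fk.
Qed.

End MeanValue.

(** * Almost openness of surjections and completeness of products *)

Section AlmostOpen.
Context {R : realType}.

Lemma closure_approx {V : normedModType R} (S : set V) y (e : R) :
  closure S y -> 0 < e -> exists2 s, S s & `|y - s| < e.
Proof.
move=> Sy e0; have [|s [Ss]] := Sy (ball y e); first exact: nbhsx_ballx.
by rewrite -ball_normE/=; exists s.
Qed.

(** Approximate solutions of [A u = v], with an error of half the size of [v],
    are enough for the iteration in [graves], which absorbs the error. *)
Definition almost_open {X V : normedModType R} (A : blin X V) (M : R) :=
  forall v, exists u, `|u| <= M * `|v| /\ `|v - A u| <= 2^-1 * `|v|.

(** By the Baire category theorem the closure of the image of some ball has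
    interior. *)
Lemma surjective_almost_open {X : normedModType R} {V : completeNormedModType R}
    (A : blin X V) : (forall v, exists u, A u = v) ->
  exists2 M : R, 0 < M & almost_open A M.
Proof.
move=> Asurj.
pose D n : set V := closure (A @` [set u | `|u| <= n%:R]).
have [n Dn] : exists n, ~ dense (~` D n).
  apply/existsNP => Ddense.
  have DG n : open (~` D n) /\ dense (~` D n).
    by split=> //; apply/closed_openC; exact: closed_closure.
  have [|v [_ Dv]] := Baire DG _ (@openT V); first by exists 0.
  have [u Au] := Asurj v.
  apply: (Dv (Num.trunc `|u|).+1) => //; apply: subset_closure.
  by exists u => //=; rewrite ltW// truncnS_gt.
have [U [U0 Uopen UD]] : exists U : set V, [/\ U !=set0, open U & U `<=` D n].
  apply: contrapT => nU; apply: Dn => U U0 Uopen.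
  apply: contrapT => UD; apply: nU; exists U; split=> // v Uv.
  by apply: contrapT => nDv; apply: UD; exists v.
case: U0 => v0 Uv0.
have /nbhs_ballP[r /= r0 rU] : nbhs v0 U by exact: open_nbhs_nbhs.
have approx v : `|v| < r -> exists2 u, `|u| <= n%:R & `|v0 + v - A u| < r / 8.
  move=> vr; have /UD/closure_approx : U (v0 + v).
    by apply: rU; rewrite -ball_normE/= opprD addNKr normrN.
  have r8 : 0 < r / 8 by lra.
  by case/(_ _ r8) => _ [u /= un <-] uv; exists u.
(* For [v] scaled to norm [r / 2], the difference of two vectors of norm at most
   [n] solves the equation up to [r / 4], half of that norm. *)
exists (4 * (n.+1)%:R / r); first by rewrite divr_gt0// mulr_gt0.
move=> v; have [->|v_neq0] := eqVneq v 0.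
  by exists 0; rewrite linear0 subr0 !normr0 !mulr0.
have v0p : 0 < `|v| by rewrite normr_gt0.
pose s := r / 2 / `|v|.
have s0 : 0 < s by rewrite !divr_gt0.
have [|u1 u1n u1v] := approx (s *: v).
  by rewrite normrZ gtr0_norm// /s divfK ?gt_eqF//; lra.
have [|u2 u2n u2v] := approx 0; first by rewrite normr0.
exists (s^-1 *: (u1 - u2)); split.
  rewrite normrZ normfV (gtr0_norm s0) ler_pdivrMl//.
  have -> : s * (4 * n.+1%:R / r * `|v|) = 2 * n.+1%:R.
    by rewrite /s; field; rewrite !gt_eqF.
  apply: le_trans (ler_normB _ _) _; rewrite -natr1; lra.
have -> : v - A (s^-1 *: (u1 - u2)) =
    s^-1 *: ((v0 + s *: v - A u1) - (v0 + 0 - A u2)).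
  rewrite linearZ linearB /=; apply: dual_ext => phi; rewrite !dualE.
  by field; rewrite gt_eqF.
rewrite normrZ normfV (gtr0_norm s0) ler_pdivrMl//.
have -> : s * (2^-1 * `|v|) = r / 4.
  by rewrite /s; field; rewrite !gt_eqF.
by apply: le_trans (ler_normB _ _) _; lra.
Qed.

End AlmostOpen.

Section ProductComplete.
Context {R : realType} {V W : completeNormedModType R}.

(* This joins the pointed and the uniform structures of the product, from which
   the complete structure is built. *)
HB.instance Definition _ := Pointed.on (V * W)%type.

Lemma prod_cauchy_cvg (F : set_system (V * W)) :
  ProperFilter F -> cauchy F -> cvg F.
Proof.
move=> FF Fc.
have /cauchyP Fex := Fc.
have F1 : cauchy (fst @ F).
  apply: cauchy_exP => e /Fex[x Fx]; exists x.1.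
  by apply: (@filterS _ F _ _ _ _ Fx) => y [].
have F2 : cauchy (snd @ F).
  apply: cauchy_exP => e /Fex[x Fx]; exists x.2.
  by apply: (@filterS _ F _ _ _ _ Fx) => y [].
apply: (@cvgP _ _ (lim (fst @ F), lim (snd @ F))) => P [[A B] /= [lA lB] AB].
have FA : F (fst @^-1` A) by exact: (cauchy_cvg _ F1 _ lA).
have FB : F (snd @^-1` B) by exact: (cauchy_cvg _ F2 _ lB).
by apply: (@filterS _ F _ _ _ _ (filterI FA FB)) => x ABx; exact: AB.
Qed.

HB.instance Definition _ := Uniform_isComplete.Build (V * W)%type prod_cauchy_cvg.
End ProductComplete.

(** * Local surjectivity of nonlinear maps *)

Section Graves.
Context {R : realType} {X : completeNormedModType R}.

Lemma geometric_steps_cvg (x : nat -> X) (C c : R) : 0 <= c < 1 ->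
  (forall n, `|x n.+1 - x n| <= C * c ^+ n) -> cvgn x.
Proof.
move=> /andP[c0 c1] step.
have C0 : 0 <= C by have := step 0%N; rewrite expr0 mulr1; exact: le_trans.
have -> : x = (fun n => x 0%N + series (telescope x) n).
  by apply/funext => n; exact: eq_sum_telescope.
apply: is_cvgD; first exact: is_cvg_cst.
apply: normed_cvg.
apply: (@series_le_cvg R _ (geometric C c)) => [n|n|n|] /=.
- exact: normr_ge0.
- by rewrite mulr_ge0// exprn_ge0.
- exact: step.
- by apply: is_cvg_geometric_series; rewrite ger0_norm.
Qed.

Context {V : normedModType R}.

(** Newton's iteration with the fixed approximate inverse of [A]. Each step
    reduces the residual [y - f x] by the factor [3 / 4]: one half is the error
    of the approximate inverse, and [q * M <= 1 / 4] bounds the deviation of [f]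
    from [A]. The steps sum up to at most [M * 4 * |y - f a|], so the iteration
    stays in the ball. *)
Theorem graves (f : X -> V) (A : blin X V) (M q r : R) (a : X) :
  0 < M -> almost_open A M -> 0 <= q -> q * M <= 4^-1 ->
  (forall x x', `|x - a| <= r -> `|x' - a| <= r ->
    `|f x - f x' - A (x - x')| <= q * `|x - x'|) ->
  forall y, 4 * M * `|y - f a| <= r -> exists2 x, `|x - a| <= r & f x = y.
Proof.
move=> M0 Ao q0 qM fA y yr.
have [inv invP] := choice Ao.
pose x n := iter n (fun z => z + inv (y - f z)) a.
set e := `|y - f a| in yr.
pose c : R := 3 / 4.
have c0 n : 0 <= c ^+ n by rewrite exprn_ge0// /c; lra.
have e0 : 0 <= e by exact: normr_ge0.
have le_r n s : s <= 4 * M * e * (1 - c ^+ n) -> s <= r.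
  move=> sle; apply: le_trans sle _; apply: le_trans yr.
  by rewrite ler_piMr ?mulr_ge0//; [lra|have := c0 n; lra].
have xP n : `|x n - a| <= 4 * M * e * (1 - c ^+ n) /\ `|y - f (x n)| <= c ^+ n * e.
  elim: n => [|n [xa yf]].
    by rewrite expr0 mul1r /x/= !subrr mulr0 normr0.
  have [invM invA] := invP (y - f (x n)).
  have xS : x n.+1 - x n = inv (y - f (x n)) by rewrite /x /= addrC addKr.
  set u := inv _ in invM invA xS.
  have uM : `|u| <= M * (c ^+ n * e).
    by apply: le_trans invM _; rewrite ler_wpM2l// ltW.
  have xnr := le_r _ _ xa.
  have xa' : `|x n.+1 - a| <= 4 * M * e * (1 - c ^+ n.+1).
    have -> : x n.+1 - a = (x n - a) + u by rewrite -xS [RHS]addrC subrKA.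
    apply: le_trans (ler_normD _ _) _; apply: le_trans (lerD xa uM) _.
    by rewrite exprS le_eqVlt; apply/orP; left; apply/eqP; rewrite /c; field.
  have xnr' := le_r _ _ xa'.
  split=> //.
  have -> : y - f (x n.+1) =
      (y - f (x n) - A u) - (f (x n.+1) - f (x n) - A (x n.+1 - x n)).
    by rewrite xS; apply: dual_ext => phi; rewrite !dualE; ring.
  apply: le_trans (ler_normB _ _) _.
  have h1 := fA _ _ xnr' xnr; rewrite xS in h1 *.
  have h2 : q * `|u| <= 4^-1 * (c ^+ n * e).
    apply: le_trans (_ : q * (M * (c ^+ n * e)) <= _); first exact: ler_wpM2l.
    by rewrite mulrA ler_wpM2r// mulr_ge0.
  have h3 : 2^-1 * `|y - f (x n)| <= 2^-1 * (c ^+ n * e) by rewrite ler_wpM2l.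
  have -> : c ^+ n.+1 * e = 2^-1 * (c ^+ n * e) + 4^-1 * (c ^+ n * e).
    by rewrite exprS /c; field.
  lra.
have xc : cvgn x.
  apply: (@geometric_steps_cvg x (M * e) c); first by rewrite /c; lra.
  move=> n; have -> : x n.+1 - x n = inv (y - f (x n)) by rewrite /x /= addrC addKr.
  apply: le_trans (invP _).1 _; rewrite -mulrA ler_wpM2l ?(ltW M0)// mulrC.
  exact: (xP n).2.
have xr n : `|x n - a| <= r := le_r _ _ (xP n).1.
pose l := limn x.
have xl : x @ \oo --> l by exact: xc.
have lr : `|l - a| <= r.
  apply/ler_addgt0Pr => d d0.
  have /cvgrPdist_le/(_ _ d0)[N _ /(_ N (leqnn N)) /= lN] := xl.
  have -> : l - a = (x N - a) + (l - x N) by rewrite [RHS]addrC subrKA.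
  by apply: le_trans (ler_normD _ _) _; apply: lerD.
exists l => //; apply/eqP; rewrite -subr_eq0 -normr_le0.
have K0 : 0 < q + opnorm A + 1 by have := opnorm_ge0 A; lra.
apply/ler_addgt0Pr => d d0; rewrite add0r.
have cz : geometric e c @ \oo --> (0 : R).
  by apply: cvg_geometric; rewrite /c ger0_norm; lra.
have d2 : 0 < d / 2 by lra.
have dK : 0 < d / 2 / (q + opnorm A + 1) by rewrite divr_gt0.
have [n [/= gn ln]] : exists n, `|0 - geometric e c n| <= d / 2 /\
    `|l - x n| <= d / 2 / (q + opnorm A + 1).
  near \oo => n; exists n; split; near: n.
  - by move/cvgrPdist_le: cz; exact.
  - by move/cvgrPdist_le: xl; exact.
have -> : f l - y = (f l - f (x n) - A (l - x n)) + A (l - x n) - (y - f (x n)).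
  by apply: dual_ext => phi; rewrite !dualE; ring.
apply: le_trans (ler_normB _ _) _.
have g1 : `|y - f (x n)| <= d / 2.
  apply: le_trans (xP n).2 _; move: gn; rewrite sub0r normrN ger0_norm ?mulr_ge0//.
  by rewrite mulrC.
have g2 : `|f l - f (x n) - A (l - x n) + A (l - x n)| <= d / 2.
  apply: le_trans (ler_normD _ _) _.
  apply: le_trans (lerD (fA _ _ lr (xr n)) (opnorm_ub _ _)) _.
  rewrite -mulrDl; move: ln; rewrite ler_pdivlMr// mulrC; apply: le_trans.
  by rewrite ler_wpM2r//; lra.
lra.
Unshelve. all: by end_near. Qed.

End Graves.

(** * Uniform convexity and first order expansions *)

Section QuadraticGrowth.
Context {R : realType} {X : normedModType R} (kappa : R).
Hypothesis growth : forall e : R, 0 <= e <= 2 ->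
  ((kappa * e ^+ 2)%:E <= convexity_modulus X e)%E.

(** The definition of the modulus of convexity, rescaled to a ball with radius
    [eps]. *)
Lemma midpoint_depth (x0 x1 x2 : X) (eps : R) : 0 < eps ->
  `|x1 - x0| <= eps -> `|x2 - x0| <= eps ->
  `|2^-1 *: (x1 + x2) - x0| <= eps - kappa / eps * `|x1 - x2| ^+ 2.
Proof.
move=> e0 x1e x2e.
pose a := eps^-1 *: (x1 - x0); pose b := eps^-1 *: (x2 - x0).
have normE x : `|eps^-1 *: x| = `|x| / eps.
  by rewrite normrZ normfV gtr0_norm// mulrC.
have ab : `|a - b| = `|x1 - x2| / eps.
  by rewrite -normE; congr (`|_|); apply: dual_ext => phi; rewrite !dualE; ring.
have a1 : `|a| <= 1 by rewrite normE ler_pdivrMr ?mul1r.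
have b1 : `|b| <= 1 by rewrite normE ler_pdivrMr ?mul1r.
have ab2 : 0 <= `|a - b| <= 2.
  by rewrite normr_ge0/=; apply: le_trans (ler_normB _ _) _; lra.
have := growth ab2; rewrite /convexity_modulus => /le_trans.
move=> /(_ (1 - `|2^-1 *: (a + b)|)%:E) H.
have {H} : kappa * `|a - b| ^+ 2 <= 1 - `|2^-1 *: (a + b)|.
  by rewrite -lee_fin; apply: H; apply: ereal_inf_lbound; exists (a, b).
have -> : 2^-1 *: (a + b) = eps^-1 *: (2^-1 *: (x1 + x2) - x0).
  by apply: dual_ext => phi; rewrite !dualE; field; rewrite gt_eqF.
rewrite normE ab => H.
have -> : kappa / eps * `|x1 - x2| ^+ 2 = eps * (kappa * (`|x1 - x2| / eps) ^+ 2).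
  by field; rewrite gt_eqF.
rewrite lerBrDr -lerBrDl.
have -> : eps - `|2^-1 *: (x1 + x2) - x0| =
    eps * (1 - `|2^-1 *: (x1 + x2) - x0| / eps) by field; rewrite gt_eqF.
by rewrite ler_pM2l.
Qed.

(** For [t <= 1 / 2] the point is the combination with weights [1 - 2 t] and
    [2 t] of [x1] and of the midpoint, and depth is concave. *)
Lemma convex_comb_depth (x0 x1 x2 : X) (eps t : R) : 0 <= kappa -> 0 < eps ->
  `|x1 - x0| <= eps -> `|x2 - x0| <= eps -> 0 <= t <= 1 ->
  `|(1 - t) *: x1 + t *: x2 - x0| <=
    eps - 2 * kappa / eps * (t * (1 - t) * `|x1 - x2| ^+ 2).
Proof.
move=> k0 e0.
wlog th : x1 x2 t / t <= 2^-1 => [hwlog x1e x2e /andP[t0 t1]|x1e x2e /andP[t0 t1]].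
  have [th|th] := leP t 2^-1; first by apply: hwlog => //; rewrite t0.
  have := hwlog x2 x1 (1 - t).
  rewrite subKr [t *: _ + _]addrC [`|x2 - x1|]distrC [(1 - t) * t]mulrC.
  by apply=> //; lra.
have -> : (1 - t) *: x1 + t *: x2 - x0 =
    (1 - 2 * t) *: (x1 - x0) + (2 * t) *: (2^-1 *: (x1 + x2) - x0).
  by apply: dual_ext => phi; rewrite !dualE; field.
apply: le_trans (ler_normD _ _) _; rewrite (normrZ (1 - 2 * t)) (normrZ (2 * t)).
rewrite (ger0_norm (_ : 0 <= 1 - 2 * t)); last by lra.
rewrite (ger0_norm (_ : 0 <= 2 * t)); last by lra.
have m := midpoint_depth e0 x1e x2e.
have h1 : (1 - 2 * t) * `|x1 - x0| <= (1 - 2 * t) * eps by rewrite ler_wpM2l//; lra.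
have h2 := ler_wpM2l (_ : 0 <= 2 * t) m.
apply: le_trans (lerD h1 (h2 _)) _; first by lra.
have K0 : 0 <= kappa / eps * `|x1 - x2| ^+ 2.
  by rewrite mulr_ge0 ?exprn_ge0// divr_ge0// ltW.
have : 0 <= 2 * t ^+ 2 * (kappa / eps * `|x1 - x2| ^+ 2).
  by rewrite mulr_ge0// mulr_ge0// exprn_ge0.
set K := kappa / eps * _ => H.
have -> : 2 * kappa / eps * (t * (1 - t) * `|x1 - x2| ^+ 2) =
    2 * t * K - 2 * t ^+ 2 * K.
  by rewrite /K; field; rewrite gt_eqF.
lra.
Qed.

End QuadraticGrowth.

Section SmoothOnBall.
Context {R : realType} {X V : normedModType R}.
Variables (f : X -> V) (Df : X -> blin X V) (x0 : X) (rho L : R).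
Hypotheses (fdiff : forall x, `|x - x0| <= rho -> is_diff x f (Df x))
  (DfL : forall x x', `|x - x0| <= rho -> `|x' - x0| <= rho ->
    `|Df x - Df x'| <= L * `|x - x'|).

Lemma segment_in_ball (a b : X) (t : R) : `|a - x0| <= rho -> `|b - x0| <= rho ->
  0 <= t <= 1 -> `|a + t *: (b - a) - x0| <= rho.
Proof.
move=> ar br /andP[t0 t1].
have -> : a + t *: (b - a) - x0 = (1 - t) *: (a - x0) + t *: (b - x0).
  by apply: dual_ext => phi; rewrite !dualE; ring.
apply: le_trans (ler_normD _ _) _; rewrite !normrZ !ger0_norm//; last by lra.
have h1 : (1 - t) * `|a - x0| <= (1 - t) * rho by rewrite ler_wpM2l//; lra.
have h2 : t * `|b - x0| <= t * rho by rewrite ler_wpM2l.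
lra.
Qed.

Lemma linear_deviation : 0 <= L -> forall x x',
  `|x - x0| <= rho -> `|x' - x0| <= rho ->
  `|f x - f x' - Df x0 (x - x')| <= (L * rho) * `|x - x'|.
Proof.
move=> L0 x x' xr xr'.
apply: (@mean_value_deviation R X V f Df) => t t01;
  have seg := segment_in_ball xr' xr t01.
  exact: fdiff.
apply: le_trans (DfL seg _) _; last by rewrite ler_wpM2l.
by rewrite subrr normr0; apply: le_trans xr.
Qed.

Lemma first_order_deviation : 0 <= L -> forall x y,
  `|x - x0| <= rho -> `|y - x0| <= rho ->
  `|f x - f y - Df y (x - y)| <= L * `|x - y| ^+ 2.
Proof.
move=> L0 x y xr yr; rewrite expr2 mulrA.
apply: (@mean_value_deviation R X V f Df) => t t01;
  have seg := segment_in_ball yr xr t01.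
  exact: fdiff.
apply: le_trans (DfL seg yr) _; rewrite ler_wpM2l// addrC addKr normrZ.
by case/andP: t01 => t0 t1; rewrite ger0_norm// ler_piMl.
Qed.

(** Expand [f] to first order at [(1 - t) x1 + t x2]: the linear terms cancel, and
    the remainders have weights [(1 - t) t^2] and [t (1 - t)^2], whose sum is
    [t (1 - t)]. *)
Lemma chord_deviation : 0 <= L -> forall x1 x2 (t : R),
  `|x1 - x0| <= rho -> `|x2 - x0| <= rho -> 0 <= t <= 1 ->
  `|(1 - t) *: f x1 + t *: f x2 - f ((1 - t) *: x1 + t *: x2)| <=
    L * (t * (1 - t) * `|x1 - x2| ^+ 2).
Proof.
move=> L0 x1 x2 t x1r x2r t01; have /andP[t0 t1] := t01.
set y := (1 - t) *: x1 + t *: x2.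
have yr : `|y - x0| <= rho.
  have -> : y = x1 + t *: (x2 - x1) by apply: dual_ext => phi; rewrite !dualE; ring.
  exact: segment_in_ball.
have d1 : x1 - y = t *: (x1 - x2) by apply: dual_ext => phi; rewrite !dualE; ring.
have d2 : x2 - y = - (1 - t) *: (x1 - x2).
  by apply: dual_ext => phi; rewrite !dualE; ring.
have -> : (1 - t) *: f x1 + t *: f x2 - f y =
    (1 - t) *: (f x1 - f y - Df y (x1 - y)) + t *: (f x2 - f y - Df y (x2 - y)).
  rewrite d1 d2 (linearZ_LR (Df y) t) (linearZ_LR (Df y) (- (1 - t))).
  by apply: dual_ext => phi; rewrite !dualE; ring.
apply: le_trans (ler_normD _ _) _; rewrite !normrZ !ger0_norm//; last by lra.
have := first_order_deviation L0 x1r yr; have := first_order_deviation L0 x2r yr.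
rewrite {2}d1 {2}d2 !normrZ normrN !ger0_norm//; last by lra.
rewrite !exprMn => h2 h1.
have g1 := ler_wpM2l (_ : 0 <= 1 - t) h1; have g2 := ler_wpM2l t0 h2.
apply: le_trans (lerD (g1 _) g2) _; first by lra.
by rewrite le_eqVlt; apply/orP; left; apply/eqP; ring.
Qed.

End SmoothOnBall.

(** * Strongly convex images and strongly concave maxima *)

Section StronglyConvexImage.
Context {R : realType} {X : completeNormedModType R} {V : normedModType R}.

(** The point [z] is at distance at most [(L + c) t (1 - t) |x1 - x2|^2] from
    [F ((1 - t) x1 + t x2)], and [graves] applies in the largest ball around
    [(1 - t) x1 + t x2] that [convex_comb_depth] provides. The bound on
    [(L + c) * eps] compares the two radii. *)
Theorem strongly_convex_image (F : X -> V) (A : blin X V)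
    (M q L c rho kappa eps : R) (x0 : X) :
  0 < M -> almost_open A M -> 0 <= q -> q * M <= 4^-1 ->
  (forall x x', `|x - x0| <= rho -> `|x' - x0| <= rho ->
    `|F x - F x' - A (x - x')| <= q * `|x - x'|) ->
  0 < eps <= rho ->
  (forall x1 x2 t, `|x1 - x0| <= eps -> `|x2 - x0| <= eps -> 0 <= t <= 1 ->
    `|(1 - t) *: F x1 + t *: F x2 - F ((1 - t) *: x1 + t *: x2)| <=
      L * (t * (1 - t) * `|x1 - x2| ^+ 2)) ->
  0 <= kappa ->
  (forall e : R, 0 <= e <= 2 ->
    ((kappa * e ^+ 2)%:E <= convexity_modulus X e)%E) ->
  4 * M * (L + c) * eps <= 2 * kappa ->
  forall x1 x2 t z, `|x1 - x0| <= eps -> `|x2 - x0| <= eps -> 0 <= t <= 1 ->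
    `|z - ((1 - t) *: F x1 + t *: F x2)| <= c * (t * (1 - t) * `|x1 - x2| ^+ 2) ->
    exists2 x, `|x - x0| <= eps & F x = z.
Proof.
move=> M0 Ao q0 qM FA /andP[e0 erho] chord k0 growth Lc x1 x2 t z x1e x2e t01 zt.
set y := (1 - t) *: x1 + t *: x2.
set D := t * (1 - t) * `|x1 - x2| ^+ 2 in zt.
have yd := convex_comb_depth growth k0 e0 x1e x2e t01; rewrite -/y -/D in yd.
have in_ball x : `|x - y| <= 2 * kappa / eps * D -> `|x - x0| <= eps.
  move=> xy; have -> : x - x0 = (x - y) + (y - x0) by rewrite subrKA.
  by apply: le_trans (ler_normD _ _) _; lra.
have FA' x x' : `|x - y| <= 2 * kappa / eps * D ->
    `|x' - y| <= 2 * kappa / eps * D ->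
    `|F x - F x' - A (x - x')| <= q * `|x - x'|.
  by move=> /in_ball xe /in_ball xe'; apply: FA; lra.
have [|x xy Fx] := graves M0 Ao q0 qM FA' (y:=z); last first.
  by exists x => //; exact: in_ball.
have D0 : 0 <= D by case/andP: t01 => t0 t1; rewrite !mulr_ge0 ?exprn_ge0//; lra.
have zF : `|z - F y| <= (L + c) * D.
    have -> : z - F y = (z - ((1 - t) *: F x1 + t *: F x2)) +
        ((1 - t) *: F x1 + t *: F x2 - F y) by rewrite subrKA.
    apply: le_trans (ler_normD _ _) _.
    by have := chord _ _ _ x1e x2e t01; rewrite -/y -/D; lra.
apply: le_trans (_ : 4 * M * ((L + c) * D) <= _).
    by rewrite ler_wpM2l// mulr_ge0// ltW.
by rewrite mulrA ler_wpM2r// ler_pdivlMr.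
Qed.

End StronglyConvexImage.

Section Maximum.
Context {R : realType} {X : completeNormedModType R}.

(** By the last hypothesis, two points whose values are within [e] of the
    supremum are at squared distance at most [e / c]. Hence the filter of almost
    maximizing points is Cauchy, and its limit is the only maximizer. *)
Lemma strongly_concave_max (S : set X) (u : X -> R) (c b : R) :
  closed S -> S !=set0 -> (forall x, S x -> {for x, continuous u}) ->
  (forall x, S x -> u x <= b) -> 0 < c ->
  (forall x1 x2, S x1 -> S x2 ->
    exists2 x, S x & (u x1 + u x2) / 2 + c * `|x1 - x2| ^+ 2 <= u x) ->
  exists2 xm, S xm & forall x, S x -> u x <= u xm /\ (u xm <= u x -> x = xm).
Proof.
move=> Sclosed [a Sa] ucont ub c0 mid.
pose s := sup (u @` S).
have hs : has_sup (u @` S).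
  by split; [exists (u a), a|exists b => _ [x Sx <-]; exact: ub].
have us x : S x -> u x <= s by move=> Sx; apply: (ub_le_sup hs.2); exists x.
pose T e : set X := [set x | S x /\ s - e < u x].
have Tne e : 0 < e -> exists x, T e x.
  by move=> e0; have [_ [x Sx <-] ex] := sup_adherent e0 hs; exists x.
have Tclose e x y : T e x -> T e y -> c * `|x - y| ^+ 2 <= e.
  move=> [Sx ex] [Sy ey]; have [z Sz] := mid _ _ Sx Sy.
  by have := us z Sz; lra.
pose F : set_system X := filter_from [set e : R | 0 < e] T.
have FF : ProperFilter F.
  apply: filter_from_proper; last by move=> e /Tne.
  apply: filter_from_filter; first by exists 1 => /=.
  move=> i j /= i0 j0; exists (Num.min i j); first by rewrite lt_min i0.
  have m1 : Num.min i j <= i by rewrite ge_min lexx.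
  have m2 : Num.min i j <= j by rewrite ge_min lexx orbT.
  by move=> x [Sx ex]; split; split => //; lra.
have Fc : cauchy F.
  apply: cauchy_exP => d d0.
  have e0 : 0 < c * d ^+ 2 / 2 by rewrite divr_gt0// mulr_gt0// exprn_gt0.
  have [x Tx] := Tne _ e0; exists x; exists (c * d ^+ 2 / 2) => // y Ty.
  rewrite -ball_normE/= -(ltr_pXn2r (n:=2))// ?nnegrE ?(ltW d0)//.
  rewrite -(ltr_pM2l c0); apply: le_lt_trans (Tclose _ _ _ Tx Ty) _; lra.
have Fl : F --> lim F := cauchy_cvg _ Fc.
set l := lim F in Fl.
have Sl : S l.
  apply: Sclosed => B /Fl[e /= e0 TB]; have [x Tx] := Tne e e0.
  by exists x; split; [case: Tx|exact: TB].
have ul : u l = s.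
  apply/le_anti; rewrite us//=; apply/ler_addgt0Pr => d d0.
  have /cvgrPdist_lt/(_ (d / 2) _) := ucont l Sl.
  rewrite divr_gt0// => /(_ isT)/Fl[e /= e0 Te].
  pose m := Num.min e (d / 2).
  have m0 : 0 < m by rewrite lt_min e0 divr_gt0.
  have m1 : m <= e by rewrite ge_min lexx.
  have m2 : m <= d / 2 by rewrite ge_min lexx orbT.
  have [x [Sx mx]] := Tne m m0.
  have : `|u l - u x| < d / 2 by apply: Te; split=> //; lra.
  by rewrite ltr_norml => /andP[]; lra.
exists l => // x Sx; split; first by rewrite ul; exact: us.
move=> lx; apply/eqP.
rewrite -subr_eq0 -normr_eq0 -sqrf_eq0 eq_le exprn_ge0// andbT.
suff : c * `|x - l| ^+ 2 <= 0 by rewrite pmulr_rle0.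
have [z Sz uz] := mid _ _ Sx Sl; have := us z Sz; lra.
Qed.

End Maximum.

(** * The convexity principle *)

Section ConvexityPrinciple.
Context {R : realType}.

(** Strong convexity of the image of the ball, measured by the distance between
    the preimages [x1] and [x2]. This is what gives convergence of maximizing
    sequences in the domain of [f], which need not be injective. *)
Definition strongly_convex_on_ball {X V : normedModType R} (f : X -> V)
    (x0 : X) (eps c : R) :=
  forall (x1 x2 : X) (t : R) (z : V),
    `|x1 - x0| <= eps -> `|x2 - x0| <= eps -> 0 <= t <= 1 ->
    `|z - ((1 - t) *: f x1 + t *: f x2)| <= c * (t * (1 - t) * `|x1 - x2| ^+ 2) ->
  exists2 x, `|x - x0| <= eps & f x = z.

Definition open_inside_ball {X V : normedModType R} (f : X -> V)
    (x0 : X) (eps : R) :=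
  forall (a : X) (r : R), 0 < r -> (forall x, `|x - a| <= r -> `|x - x0| <= eps) ->
  exists2 s : R, 0 < s &
    forall z, `|z - f a| <= s -> exists2 x, `|x - a| <= r & f x = z.

Lemma class_C11_bound {X V : normedModType R} (f : X -> V) (Omega : set X) :
  class_C11 f Omega -> exists (Df : X -> blin X V) (L : R),
    [/\ 0 < L, forall x, Omega x -> is_diff x f (Df x) &
      forall x x', Omega x -> Omega x' -> `|Df x - Df x'| <= L * `|x - x'|].
Proof.
move=> [Df fdiff [m [_ mL]]]; exists Df, (Num.max m 0 + 1).
have m1 : m <= Num.max m 0 by rewrite le_max lexx.
have m2 : 0 <= Num.max m 0 by rewrite le_max lexx orbT.
split=> //; first by lra.
move=> x x' Ox Ox'.
have /(_ (x, x')) := mL (Num.max m 0 + 1) ltac:(lra).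
by apply; split.
Qed.

(** On a ball with radius [rho] the map [f] is close enough to its derivative at
    the centre for [graves] to apply. The radius [eps0] is further reduced so
    that, with [c = L], the depth coming from uniform convexity outweighs the
    error of the first order expansion. *)
Theorem convexity_principle {X V : completeNormedModType R} (f : X -> V)
    (Omega : set X) (x0 : X) :
  open Omega -> Omega x0 -> class_C11 f Omega ->
  range ('d f x0) = [set: V] -> quadratic_growth X ->
  exists2 eps0 : R, 0 < eps0 & forall eps : R, 0 < eps <= eps0 ->
    [/\ forall x, `|x - x0| <= eps -> Omega x,
        exists b : R, forall x, `|x - x0| <= eps -> `|f x| <= b,
        exists2 c : R, 0 < c & strongly_convex_on_ball f x0 eps c &
        open_inside_ball f x0 eps].
Proof.
move=> Oopen Ox0 /class_C11_bound[Df [L [L0 fdiff DfL]]] onto [kappa k0 growth].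
have Dsurj v : exists u, Df x0 u = v.
  have dE := @diff_val _ _ _ _ _ _ _ (fdiff x0 Ox0).
  have : range ('d f x0) v by rewrite onto.
  by move=> [u _ <-]; exists u; rewrite dE.
have [M M0 Dopen] := surjective_almost_open Dsurj.
have /nbhs_ballP[r0 /= r00 ballO] : nbhs x0 Omega by exact: open_nbhs_nbhs.
pose rho := Num.min (r0 / 2) (4 * L * M)^-1.
have rho0 : 0 < rho by rewrite lt_min divr_gt0//= invr_gt0 !mulr_gt0.
have rho1 : rho <= r0 / 2 by rewrite ge_min lexx.
have rho2 : rho <= (4 * L * M)^-1 by rewrite ge_min lexx orbT.
have inO x : `|x - x0| <= rho -> Omega x.
  by move=> xr; apply: ballO; rewrite -ball_normE/= distrC; lra.
have q0 : 0 <= L * rho by rewrite mulr_ge0// ltW.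
have qM : L * rho * M <= 4^-1.
  have : 0 < L * M by rewrite mulr_gt0.
  move=> LM; have := ler_wpM2l (ltW LM) rho2.
  have -> : L * M * (4 * L * M)^-1 = 4^-1 by field; rewrite !gt_eqF.
  by rewrite mulrAC.
have fdiff' x : `|x - x0| <= rho -> is_diff x f (Df x) by move=> /inO; exact: fdiff.
have DfL' x x' : `|x - x0| <= rho -> `|x' - x0| <= rho ->
    `|Df x - Df x'| <= L * `|x - x'|.
  by move=> /inO Ox /inO Ox'; exact: DfL.
have dev := linear_deviation fdiff' DfL' (ltW L0).
pose eps0 := Num.min rho (kappa / (4 * M * L)).
exists eps0.
  by rewrite lt_min rho0 divr_gt0// !mulr_gt0.
move=> eps /andP[e0]; rewrite le_min => /andP[erho ekappa].
have in_rho x : `|x - x0| <= eps -> `|x - x0| <= rho by move=> xe; lra.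
split.
- by move=> x /in_rho; exact: inO.
- exists (L * rho * eps + opnorm (Df x0) * eps + `|f x0|) => x xe.
  have -> : f x = (f x - f x0 - Df x0 (x - x0)) + Df x0 (x - x0) + f x0.
    by rewrite !subrK.
  apply: le_trans (ler_normD _ _) _; rewrite lerD2r.
  apply: le_trans (ler_normD _ _) _; apply: lerD.
    have x0r : `|x0 - x0| <= rho by rewrite subrr normr0 ltW.
    by apply: le_trans (dev _ _ (in_rho _ xe) x0r) _; rewrite ler_wpM2l.
  by apply: le_trans (opnorm_ub _ _) _; rewrite ler_wpM2l// opnorm_ge0.
- exists L => // x1 x2 t z x1e x2e t01.
  apply: (strongly_convex_image M0 Dopen q0 qM dev _ _ (ltW k0) growth) => //.
  + by rewrite e0.
  + move=> y1 y2 s y1e y2e.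
    apply: chord_deviation fdiff' DfL' (ltW L0) _ _ _ _ _; exact: in_rho.
  + move: ekappa; rewrite ler_pdivlMr ?mulr_gt0// => H; lra.
- move=> a r r_gt0 ar.
  have dev' x x' : `|x - a| <= r -> `|x' - a| <= r ->
      `|f x - f x' - Df x0 (x - x')| <= L * rho * `|x - x'|.
    by move=> /ar xe /ar xe'; apply: dev; exact: in_rho.
  exists (r / (4 * M)); first by rewrite divr_gt0// mulr_gt0.
  move=> z za; apply: (graves M0 Dopen q0 qM dev').
  by rewrite mulrC -ler_pdivlMr// mulr_gt0.
Qed.

End ConvexityPrinciple.

Section PairMaps.
Context {R : realType} {X W Y : normedModType R}.

Lemma bounded_linear_pair (S : blin X W) (T : blin X Y) :
  (fun x => (S x, T x)) \in @bounded_linear R X (W * Y)%type.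
Proof.
apply/bounded_linearP; split.
  by move=> t x y; rewrite !linearP.
move=> x; apply: (cvg_pair (F:=nbhs x)); exact: blin_continuous.
Qed.

Definition blin_pair (S : blin X W) (T : blin X Y) : blin X (W * Y)%type :=
  Blin (bounded_linear_pair S T).

Lemma blin_pair_dist_le S S' T T' (k : R) : `|S - S'| <= k -> `|T - T'| <= k ->
  `|blin_pair S T - blin_pair S' T'| <= k.
Proof.
move=> Sk Tk; apply: opnorm_le => x x1.
have k0 : 0 <= k by apply: le_trans Sk.
have le_k (Z : normedModType R) (U : blin X Z) : `|U| <= k -> `|U x| <= k.
  move=> Uk; apply: le_trans (opnorm_ub _ _) _; apply: le_trans _ Uk.
  by rewrite ler_piMr// opnorm_ge0.
rewrite prod_normE ge_max; apply/andP; split.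
  exact: (le_k _ (S - S')).
exact: (le_k _ (T - T')).
Qed.

Lemma class_C11_pair (h : X -> W) (g : X -> Y) (Omega : set X) :
  class_C11 h Omega -> class_C11 g Omega -> class_C11 (fun x => (h x, g x)) Omega.
Proof.
move=> [Dh hdiff hlip] [Dg gdiff glip].
exists (fun x => blin_pair (Dh x) (Dg x)) => [x Ox|].
  by have := is_diff_pair (hdiff x Ox) (gdiff x Ox).
rewrite /lipschitz_on; near=> k.
have hk : k.-lipschitz_Omega Dh by near: k.
have gk : k.-lipschitz_Omega Dg by near: k.
by move=> [x x'] xx'; apply: blin_pair_dist_le;
  [exact: (hk (x, x') xx')|exact: (gk (x, x') xx')].
Unshelve. all: by end_near. Qed.

End PairMaps.

(** * Scalarization and multipliers *)

Section VectorOptimum.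
Context {R : realType}.

(** Pointedness excludes that [K] is the whole space, and a point [w'] outside
    of [K] is separated from [K] by separating [0] from the convex set
    [ball(w', r) - K], which has interior. *)
Lemma dual_cone_nonzero {W : normedModType R} (K : set W) :
  (exists w : W, w != 0) -> cone K -> closed K -> convex_set K -> pointed_cone K ->
  exists ws, (dual_cone K `\ 0) ws.
Proof.
move=> [w w0] [[k0 Kk0] KZ] Kclosed Kconvex Kpointed.
have K0 : K 0 by rewrite -(scale0r k0); exact: KZ.
have [w' Kw'] : exists w', ~ K w'.
  apply: contrapT => /forallNP KT; move/eqP: w0; apply.
  have KT' x : K x by apply: contrapT; exact: KT.
  have : (K `&` -%R @` K) w by split=> //; exists (- w); rewrite ?opprK.
  by rewrite Kpointed.
have /nbhs_ballP[r /= r0 rK] : nbhs w' (~` K).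
  by apply: open_nbhs_nbhs; split=> //; exact: closed_openC.
pose A := [set x : W | exists b k, [/\ `|b - w'| < r, K k & x = b - k]].
have Aw' x : `|x - w'| < r -> A x by move=> xr; exists x, 0; rewrite subr0.
have Aconvex : convex_set A.
  apply/convex_setP => _ _ t [b1 [k1 [b1r Kk1 ->]]] [b2 [k2 [b2r Kk2 ->]]] t01.
  exists ((1 - t) *: b1 + t *: b2), ((1 - t) *: k1 + t *: k2); split.
  - have -> : (1 - t) *: b1 + t *: b2 - w' = (1 - t) *: (b1 - w') + t *: (b2 - w').
      by apply: dual_ext => phi; rewrite !dualE; ring.
    case/andP: t01 => t0 t1; apply: le_lt_trans (ler_normD _ _) _.
    rewrite !normrZ !ger0_norm//; last by lra.
    have [->|tn0] := eqVneq t 0; first by rewrite subr0 mul1r mul0r addr0.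
    have tp : 0 < t by rewrite lt_neqAle eq_sym tn0.
    have h2 : t * `|b2 - w'| < t * r by rewrite ltr_pM2l.
    have t1' : 0 <= 1 - t by lra.
    have h1 := ler_wpM2l t1' (ltW b1r).
    lra.
  - exact: (convex_setP K).1.
  - by apply: dual_ext => phi; rewrite !dualE; ring.
have A0 : ~ A° 0.
  move=> /interior_subset[b [k [br Kk /esym/eqP]]]; rewrite subr_eq0 => /eqP bk.
  by apply: (rK b); [rewrite -ball_normE/= distrC|rewrite bk].
have [phi []] := convex_separation Aconvex r0 Aw' A0.
have phi0 : (phi 0 : R) = 0 by rewrite -(scale0r (0 : W)) dualZ mul0r.
rewrite phi0 => phiw' phiA.
exists phi; split; last by move=> /= phi_0; move: phiw'; rewrite phi_0 ltxx.
move=> k Kk; rewrite leNgt; apply/negP => phik.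
(* A negative value [phi k] would make [phi (w' - t k)] positive for large [t]. *)
pose t : R := 2 * ((phi w' : R) / phi k).
have t0 : 0 <= t by rewrite mulr_ge0// mulr_le0// ?invr_le0 ltW.
have : phi (w' - t *: k) <= 0.
  by apply: phiA; exists w', (t *: k); rewrite subrr normr0; split => //; exact: KZ.
rewrite dualB dualZ /t -mulrA divfK ?lt_eqF//; move: phiw'; lra.
Qed.

Context {X W Y : normedModType R} (h : X -> W) (g : X -> Y).

Definition feasible (C : set Y) (x0 : X) (eps : R) : set X :=
  [set x | `|x - x0| <= eps /\ C (g x)].

Lemma closed_feasible (C : set Y) x0 eps : closed C ->
  (forall x, `|x - x0| <= eps -> {for x, continuous g}) ->
  closed (feasible C x0 eps).
Proof.
move=> Cclosed gcont x clx.
have xe : `|x - x0| <= eps.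
  apply/ler_addgt0Pr => d d0; have [y [yx0 _] yx] := closure_approx clx d0.
  have -> : x - x0 = (y - x0) + (x - y) by rewrite [RHS]addrC subrKA.
  by apply: le_trans (ler_normD _ _) _; lra.
split=> //; apply: Cclosed => U gU.
by have [y [[_ Cy] Uy]] := clx _ (gcont x xe U gU); exists (g y).
Qed.

(** The image of the ball contains the mean of the two image points, moved by a
    multiple of [|x1 - x2|^2] in the direction [(w1, 0)]. This movement leaves
    the second component in [C]. *)
Lemma midpoint_gain (C : set Y) x0 (eps c : R) (ws : dual W) (w1 : W) :
  convex_set C -> 0 < c -> strongly_convex_on_ball (fun x => (h x, g x)) x0 eps c ->
  `|w1| <= 1 ->
  forall x1 x2, feasible C x0 eps x1 -> feasible C x0 eps x2 ->
    exists2 x, feasible C x0 eps x &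
      ((ws (h x1) : R) + ws (h x2)) / 2 + c / 4 * (ws w1 : R) * `|x1 - x2| ^+ 2 <=
      ws (h x).
Proof.
move=> Cconvex c0 sc w11 x1 x2 [x1e Cx1] [x2e Cx2].
pose d := c / 4 * `|x1 - x2| ^+ 2.
have d0 : 0 <= d by rewrite mulr_ge0 ?exprn_ge0//; lra.
have half01 : 0 <= (2^-1 : R) <= 1 by lra.
have [|x xe [hx gx]] := sc x1 x2 2^-1
    ((1 - 2^-1) *: h x1 + 2^-1 *: h x2 + d *: w1, (1 - 2^-1) *: g x1 + 2^-1 *: g x2)
    x1e x2e half01.
  rewrite prod_normE /= ge_max.
  have -> : c * (2^-1 * (1 - 2^-1) * `|x1 - x2| ^+ 2) = d by rewrite /d; field.
  rewrite subrr normr0 d0 andbT addrAC subrr add0r normrZ ger0_norm//.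
  by rewrite ler_piMr.
exists x; first by split=> //; rewrite gx; apply: (convex_setP C).1.
by rewrite hx !dualE /d le_eqVlt; apply/orP; left; apply/eqP; field.
Qed.

(** If [(h xe, 0)] were interior to the set [A] below, so would be
    [(h xe + tau w1, 0)] for a small [tau > 0]; this gives a feasible point with
    a value under [ws] larger than that of [xe]. *)
Lemma multiplier_of_maximum (K : set W) (C : set Y) x0 xe (eps c : R)
    (ws : dual W) (w1 : W) :
  convex_set K -> K 0 -> dual_cone K ws -> `|w1| <= 1 -> 0 < ws w1 ->
  convex_set C -> C (g x0) ->
  0 < eps -> 0 <= c -> strongly_convex_on_ball (fun x => (h x, g x)) x0 eps c ->
  open_inside_ball (fun x => (h x, g x)) x0 eps ->
  (forall x, feasible C x0 eps x -> ws (h x) <= ws (h xe)) ->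
  exists phi : dual (W * Y)%type, phi (h x0, 0) < phi (h xe, 0) /\
    forall x k y, `|x - x0| <= eps -> K k -> C y ->
      phi (h x - k, g x - y) <= phi (h xe, 0).
Proof.
move=> Kconvex K0 wsK w11 w1p Cconvex Cx0 e0 c0 sc opened xemax.
pose A := [set z : W * Y | exists x k y,
  [/\ `|x - x0| <= eps, K k, C y & z = (h x - k, g x - y)]].
have Aconvex : convex_set A.
  apply/convex_setP => _ _ t [x1 [k1 [y1 [x1e Kk1 Cy1 ->]]]]
    [x2 [k2 [y2 [x2e Kk2 Cy2 ->]]]] t01.
  have [|x xe' [hx gx]] := sc x1 x2 t
      ((1 - t) *: (h x1, g x1) + t *: (h x2, g x2)) x1e x2e t01.
    rewrite subrr normr0 mulr_ge0// mulr_ge0 ?exprn_ge0//.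
    by case/andP: t01 => t0 t1; rewrite mulr_ge0//; lra.
  exists x, ((1 - t) *: k1 + t *: k2), ((1 - t) *: y1 + t *: y2); split => //.
  - exact: (convex_setP K).1.
  - exact: (convex_setP C).1.
  - rewrite hx gx; congr (_, _) => /=.
      by apply: dual_ext => phi; rewrite !dualE; ring.
    by apply: dual_ext => phi; rewrite !dualE; ring.
have [s s0 sA] := opened x0 eps e0 (fun _ => id).
(* The ball around [(h x0, g x0)] contained in the image, shifted by [(0, g x0)]. *)
have Aball z : `|z - (h x0, 0)| < s -> A z.
  case: z => w y zs; have [|x xe' [hx gx]] := sA (w, y + g x0).
    by move/ltW: zs; rewrite !prod_normE /= addrK subr0.
  by exists x, 0, (g x0); rewrite hx gx subr0 addrK.
have Axe : ~ A° (h xe, 0).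
  move=> /nbhs_ballP[r /= r0 rA].
  have [|x [k [y [xe' Kk Cy]]]] := rA (h xe + (r / 2) *: w1, 0).
    rewrite -ball_normE /= prod_normE /= subrr normr0 opprD addNKr normrN.
    rewrite normrZ ger0_norm ?gt_max; last by lra.
    rewrite r0 andbT.
    have : r / 2 * `|w1| <= r / 2 by rewrite ler_piMr//; lra.
    lra.
  move=> [hx /esym/eqP]; rewrite subr_eq0 => /eqP gx.
  have := xemax x (conj xe' _); rewrite gx => /(_ Cy).
  have -> : h x = h xe + (r / 2) *: w1 + k by rewrite hx subrK.
  have := wsK k Kk; have : 0 < r / 2 * ws w1 by rewrite mulr_gt0//; lra.
  rewrite !dualE; lra.
have [phi [phi0 phiA]] := convex_separation Aconvex s0 Aball Axe.
by exists phi; split=> // x k y xe' Kk Cy; apply: phiA; exists x, k, y.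
Qed.

End VectorOptimum.

(** * Optima on small balls *)

Section DualOfProduct.
Context {R : realType} {W Y : normedModType R} (phi : dual (W * Y)%type).

Lemma dual_fst_bounded : (fun w => phi (w, 0)) \in @bounded_linear R W R^o.
Proof.
apply/bounded_linearP; split.
  move=> t x y; rewrite -(linearP phi); congr (phi _).
  by congr (_, _); rewrite /= scaler0 addr0.
move=> w; apply: (@continuous_comp _ _ _ (fun w => (w, 0)) phi).
  by apply: (cvg_pair (F:=nbhs w)); [exact: cvg_id|exact: cvg_cst].
exact: blin_continuous.
Qed.

Lemma dual_snd_bounded : (fun y => phi (0, y)) \in @bounded_linear R Y R^o.
Proof.
apply/bounded_linearP; split.
  move=> t x y; rewrite -(linearP phi); congr (phi _).
  by congr (_, _); rewrite /= scaler0 addr0.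
move=> y; apply: (@continuous_comp _ _ _ (fun y => (0, y)) phi).
  by apply: (cvg_pair (F:=nbhs y)); [exact: cvg_cst|exact: cvg_id].
exact: blin_continuous.
Qed.

Definition dual_fst : dual W := Blin dual_fst_bounded.
Definition dual_snd : dual Y := Blin dual_snd_bounded.

Lemma dual_pairE w y : (phi (w, y) : R) = (dual_fst w : R) + dual_snd y.
Proof.
rewrite -[RHS](dualD phi (w, 0) (0, y)); congr (phi _).
by congr (_, _); rewrite /= ?addr0 ?add0r.
Qed.

End DualOfProduct.

Theorem theorem3p1 (R : realType) (X W Y : completeNormedModType R)
    (h : X -> W) (g : X -> Y) (K : set W) (C : set Y) (Omega : set X) (x0 : X)
    (W_nontrivial : exists w : W, w != 0)
    (K_cone : cone K) (K_closed : closed K) (K_convex : convex_set K)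
    (K_pointed : pointed_cone K)
    (C_nonempty : C !=set0) (C_closed : closed C) (C_convex : convex_set C)
    (Omega_open : open Omega) (x0_in : (Omega `&` g @^-1` C) x0)
    (X_uconvex : uniformly_convex X) (X_quadratic : quadratic_growth X)
    (W_reflexive : reflexive_space W) (Y_reflexive : reflexive_space Y)
    (h_C11 : class_C11 h Omega) (g_C11 : class_C11 g Omega)
    (Dhg_onto : range ('d (fun x => (h x, g x)) x0) = [set: W * Y]) :
  exists2 eps0 : R, 0 < eps0 & forall eps : R, 0 < eps <= eps0 ->
    exists (xe : X) (ws : dual W) (ys : dual Y),
      [/\ boundary (closed_ball x0 eps) xe,
          (ws, ys) != (0, 0),
          VOP_solution h g K C x0 eps xe,
          (dual_cone K `\ 0) ws /\ normal_cone (g xe) C (- ys) &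
          forall x, closed_ball x0 eps x ->
            lagrangian h g ws ys x <= lagrangian h g ws ys xe].
Proof.
case: x0_in => Ox0 Cx0.
pose f x := (h x, g x).
have [eps0 eps0_gt0 ball_f] := convexity_principle Omega_open Ox0
  (class_C11_pair h_C11 g_C11) Dhg_onto X_quadratic.
exists eps0 => // eps eps_le; have /andP[e0 _] := eps_le.
have [inO [b fb] [c c0 sc] opened] := ball_f eps eps_le.
have cball x : closed_ball x0 eps x <-> `|x - x0| <= eps.
  by rewrite closed_ballE//= /closed_ball_/= distrC.
have x0e : `|x0 - x0| <= eps by rewrite subrr normr0 ltW.
have diff_cont (Z : normedModType R) (k : X -> Z) : class_C11 k Omega ->
    forall x, `|x - x0| <= eps -> {for x, continuous k}.
  move=> [Dk kdiff _] x /inO /kdiff kx; exact: differentiable_continuous.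
have hcont := diff_cont _ h h_C11; have gcont := diff_cont _ g g_C11.
have K0 : K 0.
  by case: K_cone => -[k Kk] KZ; rewrite -(scale0r k); exact: KZ.
have [ws [wsK ws0]] := 
  dual_cone_nonzero W_nontrivial K_cone K_closed K_convex K_pointed.
have [w1 w11 w1p] : exists2 w1, `|w1| <= 1 & 0 < ws w1.
  have [w wsw] : exists w, 0 < ws w.
    apply: contrapT => /forallNP wsn; apply: ws0; apply/val_inj/funext => w /=.
    apply/le_anti; rewrite [X in X && _]leNgt [X in _ && X]leNgt.
    apply/andP; split; apply/negP; first exact: wsn.
    by move=> wsw; apply: (wsn (- w)); rewrite dualN oppr_gt0.
  have w_gt0 : 0 < `|w|.
    rewrite normr_gt0; apply/eqP => w0; move: wsw.
    by rewrite w0 -(scale0r w) dualZ mul0r ltxx.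
  exists (`|w|^-1 *: w); first by rewrite normrZ normfV normr_id mulVf ?gt_eqF.
  by rewrite dualZ mulr_gt0// invr_gt0.
have c'0 : 0 < c / 4 * ws w1 by rewrite mulr_gt0// divr_gt0.
have [xe [xee Cxe] xemax] : exists2 xm, feasible g C x0 eps xm &
    forall x, feasible g C x0 eps x ->
      ws (h x) <= ws (h xm) /\ (ws (h xm) <= ws (h x) -> x = xm).
  apply: (@strongly_concave_max R X _ (fun x => ws (h x))
    (c / 4 * (ws w1 : R)) (opnorm ws * b)).
  - exact: closed_feasible.
  - by exists x0.
  - move=> x [xe _]; apply: continuous_comp; [exact: hcont|exact: blin_continuous].
  - move=> x [xe _]; apply: le_trans (ler_norm _) _.
    apply: le_trans (opnorm_ub _ _) _.
    rewrite ler_wpM2l ?opnorm_ge0//; apply: le_trans (fb x xe).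
    by rewrite /f prod_normE le_max lexx.
  - exact: c'0.
  - exact: midpoint_gain.
have [phi [phi0 phiA]] := multiplier_of_maximum K_convex K0 wsK w11 w1p
  C_convex Cx0 e0 (ltW c0) sc opened (fun x Fx => (xemax x Fx).1).
exists xe, (dual_fst phi), (dual_snd phi).
set ws' := dual_fst phi; set ys := dual_snd phi.
have phi_ineq x k y : `|x - x0| <= eps -> K k -> C y ->
    (ws' (h x) : R) - ws' k + ((ys (g x) : R) - ys y) <= ws' (h xe).
  by move=> xe' Kk Cy; have := phiA x k y xe' Kk Cy; rewrite dual_pairE !dualB.
have ws'_lt : (ws' (h x0) : R) < ws' (h xe) by [].
have ws'0 : (ws' 0 : R) = 0 by rewrite -(scale0r (0 : W)) dualZ mul0r.
have ws'_neq0 : ws' <> 0 by move=> ws'00; move: ws'_lt; rewrite ws'00 ltxx.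
split.
- split; first by apply: subset_closure; apply/cball.
  rewrite interior_closed_ballE// -ball_normE/= distrC => xe_int.
  have [||s s0 sF] := opened xe (eps - `|xe - x0|); first by rewrite subr_gt0.
    move=> x xxe; have -> : x - x0 = (x - xe) + (xe - x0) by rewrite subrKA.
    by apply: le_trans (ler_normD _ _) _; lra.
  pose v := h xe - h x0; pose tau := s / (`|v| + 1).
  have v1 : 0 < `|v| + 1 by have := normr_ge0 v; lra.
  have tau0 : 0 < tau by rewrite divr_gt0.
  have [|x xxe [hx gx]] := sF (h xe + tau *: v, g xe).
    rewrite prod_normE /= subrr normr0 addrAC subrr add0r normrZ (gtr0_norm tau0).
    rewrite ge_max (ltW s0) andbT /tau mulrAC ler_pdivrMr// ler_wpM2l ?ltW//; lra.
  have xe' : `|x - x0| <= eps.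
    have -> : x - x0 = (x - xe) + (xe - x0) by rewrite subrKA.
    by apply: le_trans (ler_normD _ _) _; lra.
  have := phi_ineq x 0 (g xe) xe' K0 Cxe.
  have : 0 < tau * ((ws' (h xe) : R) - ws' (h x0)) by rewrite mulr_gt0// subr_gt0.
  rewrite hx gx ws'0 dualD dualZ /v dualB; lra.
- by apply/eqP => /(congr1 fst); exact: ws'_neq0.
- split; first by split=> //; apply/cball.
  apply/seteqP; split=> [_ [[x [Cx /cball xe'] <-] [k Kk hk]]|_ ->].
    have [_ xuniq] := xemax x (conj xe' Cx).
    rewrite /= xuniq// -hk dualD lerDl; exact: wsK.
  split; first by exists xe => //; split=> //; apply/cball.
  by exists 0 => //; rewrite addr0.
- split; first split=> // k Kk.
    by have := phi_ineq xe k (g xe) xee Kk Cxe; lra.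
  move=> y Cy; rewrite -[X in X <= _]/(- (ys (y - g xe) : R)) dualB.
  by have := phi_ineq xe 0 y xee K0 Cy; rewrite ws'0; lra.
- move=> x /cball xe'; rewrite /lagrangian.
  have := phi_ineq x 0 (g xe) xe' K0 Cxe; rewrite ws'0.
  rewrite -lerBlDr => ?; lra.
Qed.
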